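(* Let $-1\le\alpha\le 1$ and $\beta\ge 1$. The cosine polynomial $f(\phi)=(\cos\phi+\alpha)^2(\cos\phi+\beta)$ belongs to $C_3^0$ if and only if either (a) $\alpha\ge 1-\frac{1}{\sqrt2}$, or (b) $-\frac14<\alpha<1-\frac1{\sqrt2}$ and $\beta\in\left[1,\,1+\dfrac{4\alpha+1}{4\alpha^2-8\alpha+2}\right)$.
   Context: Every cosine polynomial $f$ of degree $n$ can be written as $f(\phi)=h(\cos\phi)$ for a unique real algebraic polynomial $h$; a double root of $f$ means a point $x_0\in[-1,1]$ that is a zero of $h$ of multiplicity at least $2$. $C_n^0$ denotes the set of degree-$n$ cosine polynomials $f(\phi)=a_0+a_1\cos\phi+\dots+a_n\cos n\phi$ with real coefficients such that: (B.1) $f$ is nonnegative on $\mathbb{R}$ and has a double root; (B.2) all coefficients are nonnegative; (B.3) $a_1>a_0>0$. *)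

(* Defs.v *)
From HB Require Import structures.
From mathcomp Require Import all_boot all_order all_algebra.
From mathcomp Require Import all_classical all_reals all_analysis.

Set Implicit Arguments.
Unset Strict Implicit.
Unset Printing Implicit Defensive.

Import Order.TTheory GRing.Theory Num.Theory.

Local Open Scope classical_set_scope.
Local Open Scope ring_scope.

(* [a : {poly R}] serves here only as a list of coefficients
   a_0, ..., a_n (a_n <> 0 when size a = n.+1): [cospoly a] is the function
   a_0 + a_1 cos phi + ... + a_n cos (n phi), not the evaluation of [a]
   at cos phi. *)
Definition cospoly (R : realType) (a : {poly R}) : R -> R :=
  fun phi => \sum_(k < size a) a`_k * cos (k%:R * phi).

(* The polynomial h is determined by f, since cos takes every value in
   [-1, 1].  For h = 0, [mup x0 h] is 0, so the zero function has no double
   root in this sense. *)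
Definition has_double_root (R : realType) (f : R -> R) : Prop :=
  exists2 h : {poly R}, (forall phi, f phi = h.[cos phi]) &
    exists2 x0 : R, -1 <= x0 <= 1 & (2 <= mup x0 h)%N.

Definition C0 (R : realType) (n : nat) : set (R -> R) :=
  [set f | exists a : {poly R},
    [/\ size a = n.+1 /\ f = cospoly a,
        (forall phi, 0 <= f phi) /\ has_double_root f,
        forall k, 0 <= a`_k
      & 0 < a`_0 < a`_1]].

(* Main.v *)
(* Writing c = cos phi and linearizing the powers of c, the cosine coefficients
   of (c + alpha)^2 (c + beta) are
     a_0 = alpha^2 beta + (2 alpha + beta) / 2,   a_2 = (2 alpha + beta) / 2,
     a_1 = alpha^2 + 2 alpha beta + 3 / 4,        a_3 = 1 / 4,
   and a_0 < a_1 reads beta D < D + 4 alpha + 1 with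
   D = 4 alpha^2 - 8 alpha + 2. On [-1, 1], D > 0 exactly when
   alpha < 1 - 1 / sqrt 2; since beta >= 1, the inequality then forces
   4 alpha + 1 > 0, while it is automatic when D <= 0. *)
Require Import Defs.
From HB Require Import structures.
From mathcomp Require Import all_boot all_order all_algebra.
From mathcomp Require Import all_classical all_reals all_analysis.
From mathcomp Require Import ring lra.

Set Implicit Arguments.
Unset Strict Implicit.
Unset Printing Implicit Defensive.

Import Order.TTheory GRing.Theory Num.Theory.

Local Open Scope classical_set_scope.
Local Open Scope ring_scope.

Lemma cos_mul2 (R : realType) (x : R) : cos (2 * x) = 2 * cos x ^+ 2 - 1.
Proof. by rewrite mulr_natl cos_mulr2n mulr_natl. Qed.

Lemma cos_mul3 (R : realType) (x : R) :
  cos (3 * x) = 4 * cos x ^+ 3 - 3 * cos x.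
Proof.
have -> : 3 * x = 2 * x + x by ring.
rewrite cosD cos_mul2.
have -> : 2 * x = x + x by ring.
rewrite sinD; have := sin2cos2 x => h.
have -> : (sin x * cos x + cos x * sin x) * sin x = 2 * cos x * sin x ^+ 2
  by ring.
by rewrite h; ring.
Qed.

Lemma cospoly_size4 (R : realType) (a : {poly R}) (phi : R) : size a = 4%N ->
  cospoly a phi = a`_0 + a`_1 * cos phi + a`_2 * (2 * cos phi ^+ 2 - 1)
                  + a`_3 * (4 * cos phi ^+ 3 - 3 * cos phi).
Proof.
move=> sa; rewrite /cospoly sa !big_ord_recr big_ord0 /=.
by rewrite cos_mul2 cos_mul3 mul0r cos0 mul1r add0r mulr1.
Qed.

(** As [acos] reaches every c in [-1, 1], the identity becomes one between cubic polynomials in c;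
    its values at 0, 1, -1 and 1/2 determine the coefficients through a linear system. *)
Lemma cospoly_size4_coef (R : realType) (a : {poly R}) (alpha beta : R) :
    size a = 4%N ->
    cospoly a = (fun phi => (cos phi + alpha) ^+ 2 * (cos phi + beta)) ->
  a`_0 = alpha ^+ 2 * beta + (2 * alpha + beta) / 2 /\
  a`_1 = alpha ^+ 2 + 2 * alpha * beta + 3 / 4 /\
  a`_2 = (2 * alpha + beta) / 2.
Proof.
move=> sa fa.
have E (c : R) : -1 <= c <= 1 ->
    a`_0 + a`_1 * c + a`_2 * (2 * c ^+ 2 - 1) + a`_3 * (4 * c ^+ 3 - 3 * c)
    = (c + alpha) ^+ 2 * (c + beta).
  by move=> hc; have := congr1 (@^~ (acos c)) fa; rewrite cospoly_size4// acosK.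
have E0 := E 0 ltac:(lra); have E1 := E 1 ltac:(lra).
have E2 := E (-1) ltac:(lra); have E3 := E (1 / 2) ltac:(lra).
by split; [|split]; lra.
Qed.

(** Nonnegativity and the double root at [- alpha] hold throughout this range of parameters, and a_3
    = 1/4; what remains is the signs of a_2, a_0 and a_1 - a_0. *)
Lemma C0_3P (R : realType) (alpha beta : R) : -1 <= alpha <= 1 -> 1 <= beta ->
  @C0 R 3 (fun phi : R => (cos phi + alpha) ^+ 2 * (cos phi + beta)) <->
  [/\ 0 <= 2 * alpha + beta,
      0 < alpha ^+ 2 * beta + (2 * alpha + beta) / 2
    & alpha ^+ 2 * beta + (2 * alpha + beta) / 2
      < alpha ^+ 2 + 2 * alpha * beta + 3 / 4].
Proof.
move=> ha hb; split.
  move=> [a [[sa fa] _ apos /andP[a0 a01]]].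
  have [e0 [e1 e2]] := cospoly_size4_coef sa (esym fa).
  by rewrite -e0 -e1; split=> //; have := apos 2%N; rewrite e2; lra.
move=> [h2 h0 h1].
set s := [:: alpha ^+ 2 * beta + (2 * alpha + beta) / 2;
             alpha ^+ 2 + 2 * alpha * beta + 3 / 4;
             (2 * alpha + beta) / 2; 1 / 4].
(* The last entry 1/4 is nonzero, so [Poly] trims nothing and the size is 4. *)
have ss : Poly s = s :> seq R by apply: (@PolyK _ 0); rewrite /=; lra.
exists (Poly s); rewrite ss; split.
- split=> //; apply/funext => phi.
  by rewrite cospoly_size4 ss //=; field.
- split=> [phi|].
    by rewrite mulr_ge0 ?sqr_ge0//; have := cos_geN1 phi; lra.
  exists (('X - (- alpha)%:P) ^+ 2 * ('X + beta%:P)).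
    by move=> phi; rewrite !hornerE opprK.
  exists (- alpha); first lra.
  rewrite mup_geq ?dvdp_mulIl// mulf_neq0 ?expf_neq0 ?polyXsubC_eq0//.
  by rewrite -size_poly_eq0 size_XaddC.
(* Here a_1 >= 0 follows from 0 < a_0 < a_1; beyond index 3 the default value is 0. *)
- by move=> [|[|[|[|k]]]] /=; rewrite ?nth_nil //; lra.
- by rewrite /= h0 h1.
Qed.

Theorem theorem2p8 (R : realType) (alpha beta : R)
    (halpha : -1 <= alpha <= 1) (hbeta : 1 <= beta) :
  @C0 R 3 (fun phi : R => (cos phi + alpha) ^+ 2 * (cos phi + beta)) <->
  (1 - 1 / Num.sqrt 2 <= alpha) \/
  (- (1 / 4) < alpha < 1 - 1 / Num.sqrt 2 /\
   1 <= beta < 1 + (4 * alpha + 1) / (4 * alpha ^+ 2 - 8 * alpha + 2)).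
Proof.
apply: (iff_trans (C0_3P halpha hbeta)).
have [t0 t2] : 0 < 1 / Num.sqrt 2 :> R /\ (1 / Num.sqrt 2) ^+ 2 = 1 / 2 :> R.
  by rewrite divr_gt0 ?sqrtr_gt0// expr_div_n sqr_sqrtr// expr1n.
move: (1 / Num.sqrt 2) t0 t2 => t t0 t2.
have t1 : 1 / 2 < t < 1 by nra.
set D := 4 * alpha ^+ 2 - 8 * alpha + 2.
(* As t^2 = 1/2, the roots of D in alpha are 1 - t and 1 + t; the last factor is positive because
   alpha <= 1, so D has the sign of 1 - t - alpha. *)
have DE : D = 4 * (1 - alpha - t) * (1 - alpha + t) by rewrite /D; lra.
have [ht|ht] := lerP (1 - t) alpha.
  split=> [_|_]; first by left.
  have D0 : D <= 0 by rewrite DE; nra.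
  have : beta * D <= D by nra.
  by rewrite /D => hD; split; nra.
have D0 : 0 < D by rewrite DE; nra.
have bE : (beta < 1 + (4 * alpha + 1) / D) = ((beta - 1) * D < 4 * alpha + 1).
  by rewrite -ltrBlDl ltr_pdivlMr.
rewrite hbeta bE /=; split.
  move=> [_ _ h]; right.
  have hD : (beta - 1) * D < 4 * alpha + 1 by rewrite /D; lra.
  by split=> //; apply/andP; split=> //; nra.
move=> [//|[/andP[h _]]]; rewrite /D => hD.
(* From alpha > -1/4 and beta >= 1 one gets 2 alpha + beta > 1/2, which settles the conditions on
   a_2 and a_0. *)
by split; nra.
Qed.
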